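(* Let $m$ be a positive integer, let $r\ge0$, let $\alpha>0$, and let $\lambda$ be a nonzero real number. Let $X$ be a Poisson random variable with parameter $\frac{\alpha}{m}$. Then for every integer $n\ge0$, $$E[(mX+r)_{n,\lambda}]=D^{(r)}_{m,\lambda}(n,\alpha).$$
   Context: For real $x$ and nonzero real $\lambda$, $(x)_{0,\lambda}=1$, $(x)_{n,\lambda}=x(x-\lambda)\cdots(x-(n-1)\lambda)$ for $n\ge1$, and $(x)_0=1$, $(x)_k=x(x-1)\cdots(x-k+1)$. The degenerate $r$-Whitney numbers of the second kind $W^{(r)}_{m,\lambda}(n,k)$ are defined by $(mx+r)_{n,\lambda}=\sum_{k=0}^nW^{(r)}_{m,\lambda}(n,k)\,m^k(x)_k$ (polynomial identity in $x$), and the degenerate $r$-Dowling polynomials are $D^{(r)}_{m,\lambda}(n,x)=\sum_{k=0}^nW^{(r)}_{m,\lambda}(n,k)x^k$. Equivalently, $e_\lambda^r(t)\,e^{\frac{x}{m}(e_\lambda^m(t)-1)}=\sum_{n\ge0}D^{(r)}_{m,\lambda}(n,x)\frac{t^n}{n!}$, where $e_\lambda^x(t)=(1+\lambda t)^{x/\lambda}$. *)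

(* Defs.v *)
From HB Require Import structures.
From mathcomp Require Import all_boot all_order all_algebra.
From mathcomp Require Import all_classical all_reals all_analysis.
From mathcomp Require Import ring.

Set Implicit Arguments.
Unset Strict Implicit.
Unset Printing Implicit Defensive.

Import Order.TTheory GRing.Theory Num.Theory.
Local Open Scope ring_scope.

Definition dffact (R : realType) (lambda x : R) (n : nat) : R :=
  \prod_(i < n) (x - i%:R * lambda).

Definition rffact (R : realType) (x : R) (k : nat) : R :=
  \prod_(i < k) (x - i%:R).

(* The identity only involves [w 0], ..., [w n]; the first clause extends the
   coefficients by zero, so that [w] is determined as a function on [nat]. *)
Definition whitney2_spec (R : realType) (m : nat) (r lambda : R) (n : nat)
    (w : nat -> R) : Prop :=
  (forall k, (n < k)%N -> w k = 0) /\
  (forall x : R, dffact lambda (m%:R * x + r) n =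
                 \sum_(k < n.+1) w k * (m%:R ^+ k * rffact x k)).

Lemma whitney2_exists (R : realType) (m : nat) (r lambda : R) (n : nat) :
  exists w : nat -> R, whitney2_spec m r lambda n w.
Proof.
elim: n => [|n [w [w0 wE]]].
  exists (fun k => (k == 0)%:R); split=> [[|k]//|x].
  by rewrite big_ord_recl big_ord0 /dffact /rffact !big_ord0 /= !mulr1 addr0.
exists (fun k => (if k is k'.+1 then w k' else 0) +
                 (m%:R * k%:R + r - n%:R * lambda) * w k); split=> [[|k]//|x].
  by rewrite ltnS => nk; rewrite !w0 ?mulr0 ?addr0 // (leq_trans nk).
rewrite /dffact big_ord_recr /= -/(dffact _ _ _) wE.
under [RHS]eq_bigr do rewrite mulrDl.
rewrite big_split /= [X in _ = X + _]big_ord_recl /= mul0r add0r.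
rewrite [X in _ = _ + X]big_ord_recr /= (w0 n.+1) // mulr0 mul0r addr0.
rewrite -big_split mulr_suml; apply: eq_bigr => i _ /=.
rewrite /bump /= add1n /rffact big_ord_recr exprS /=.
by ring.
Qed.

Lemma whitney2_unique (R : realType) (m : nat) (r lambda : R) (n : nat)
    (w1 w2 : nat -> R) : (0 < m)%N ->
  whitney2_spec m r lambda n w1 -> whitney2_spec m r lambda n w2 -> w1 =1 w2.
Proof.
move=> m_gt0 [w1_0 w1E] [w2_0 w2E] k.
have [nk|kn] := ltnP n k; first by rewrite w1_0 // w2_0.
elim/ltn_ind: k kn => k IHk kn.
have rff0 j : (k < j)%N -> rffact (k%:R : R) j = 0.
  by move=> kj; rewrite /rffact (bigD1 (Ordinal kj)) //= subrr mul0r.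
have rffk : rffact (k%:R : R) k != 0.
  by apply/prodf_neq0 => i _; rewrite subr_eq0 eqr_nat gtn_eqF.
have := w1E k%:R; rewrite w2E.
pose ik : 'I_n.+1 := Ordinal (kn : (k < n.+1)%N).
rewrite (bigD1 ik) //= [RHS](bigD1 ik) //=.
rewrite [X in _ + X = _](_ : _ =
  \sum_(j < n.+1 | j != ik) w1 j * (m%:R ^+ j * rffact (k%:R : R) j)).
  move/addIr/esym/mulIf; apply.
  by rewrite mulf_neq0 // expf_neq0 // pnatr_eq0 -lt0n.
apply: eq_bigr => j jk; have [kj|] := ltnP k j; first by rewrite rff0 // !mulr0.
rewrite leq_eqVlt => /orP[/eqP jkE|jk'].
  by rewrite -val_eqE /= jkE eqxx in jk.
by rewrite IHk // (leq_trans (ltnW jk')).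
Qed.

(* [W^(r)_(m,lambda)(n, k)]; determined by [whitney2_spec] as soon as
   [0 < m], by [whitney2_unique]. *)
Definition whitney2 (R : realType) (m : nat) (r lambda : R) (n : nat) :
    nat -> R :=
  sval (cid (whitney2_exists m r lambda n)).

Lemma whitney2P (R : realType) (m : nat) (r lambda : R) (n : nat) :
  whitney2_spec m r lambda n (whitney2 m r lambda n).
Proof. exact: svalP (cid (whitney2_exists m r lambda n)). Qed.

Definition dowling (R : realType) (m : nat) (r lambda : R) (n : nat) (x : R) :
    R :=
  \sum_(k < n.+1) whitney2 m r lambda n k * x ^+ k.

(* For [0 < rate] the masses at the naturals sum to 1, so this fixes the
   distribution of [X]. *)
Definition poisson_RV (d : measure_display) (T : measurableType d)
    (R : realType) (P : probability T R) (X : {RV P >-> R}) (rate : R) : Prop :=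
  forall k : nat, pmf X k%:R = poisson_pmf rate k.

(* Main.v *)
Require Import Defs.
From mathcomp Require Import all_boot all_order all_algebra.
From mathcomp Require Import all_classical all_reals all_analysis.
From mathcomp Require Import measurable_realfun ring.

Import Order.TTheory GRing.Theory Num.Theory.
Local Open Scope ring_scope.

(** The factorial moments of a Poisson variable are [E[(X)_k] = rate^k].
    Taking expectations term by term in
    [(m X + r)_(n,lambda) = \sum_k W(n, k) m^k (X)_k], with rate [alpha / m],
    the factor [m^k] cancels and leaves [\sum_k W(n, k) alpha^k]. *)

Lemma rffact_natr (R : realType) (j k : nat) :
  rffact (j%:R : R) k = (j ^_ k)%:R.
Proof.
elim: k => [|k IHk]; first by rewrite /rffact big_ord0.
rewrite /rffact big_ord_recr /= -/(rffact _ _) IHk ffactnSr natrM.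
(* The truncated [j - k] differs from the real difference only when [j < k], and there the common
   factor [j ^_ k] is 0. *)
have [jk|kj] := ltnP j k; last by rewrite natrB.
by rewrite ffact_small ?mul0r.
Qed.

Lemma measurable_rffact (R : realType) (k : nat) :
  measurable_fun [set: R] (fun x : R => rffact x k).
Proof. by apply: measurable_prod => i _; exact: measurable_funD. Qed.

(** The series is the total mass of the probability measure [poisson_prob]. *)
Lemma poisson_pmf_series (R : realType) (rate : R) : 0 < rate ->
  (\sum_(j <oo) (poisson_pmf rate j)%:E = 1)%E.
Proof.
move=> rate0; have := probability_setT (poisson_prob rate 0).
rewrite /= /poisson_prob rate0 -nneseries_esumT // => j.
by rewrite lee_fin poisson_pmf_ge0.
Qed.

(** Since [(i + k)! = (i + k)^_k * i!], the falling factorial turns the denominator [(i + k)!] into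
    [i!]. *)
Lemma poisson_pmf_ffact (R : realType) (rate : R) (i k : nat) : 0 < rate ->
  ((i + k) ^_ k)%:R * poisson_pmf rate (i + k) =
  rate ^+ k * poisson_pmf rate i.
Proof.
move=> rate0; rewrite /poisson_pmf rate0.
rewrite -(ffact_fact (leq_addl i k)) addnK natrM exprD; field.
by rewrite !pnatr_eq0 -!lt0n ffact_gt0 leq_addl fact_gt0.
Qed.

(** The terms with [j < k] vanish; shifted by [k], the others are [rate ^+ k] times the Poisson
    masses, which sum to 1. *)
Lemma poisson_ffact_series (R : realType) (rate : R) (k : nat) : 0 < rate ->
  (\sum_(j <oo) ((j ^_ k)%:R * poisson_pmf rate j)%:E = (rate ^+ k)%:E)%E.
Proof.
move=> rate0.
have term_ge0 j : (0 <= ((j ^_ k)%:R * poisson_pmf rate j)%:E)%E.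
  by rewrite lee_fin mulr_ge0 // poisson_pmf_ge0.
rewrite (nneseries_split 0 k) // add0n big_nat big1; last first.
  by move=> j /andP[_ jk]; rewrite ffact_small // mul0r.
rewrite add0e -nneseries_addn //.
under eq_eseriesr do rewrite poisson_pmf_ffact // EFinM.
rewrite nneseriesZl => [|i _]; last by rewrite lee_fin poisson_pmf_ge0.
by rewrite poisson_pmf_series // mule1.
Qed.

Section nat_supported.
Local Open Scope ereal_scope.
Local Open Scope classical_set_scope.
Context {R : realType} {d : measure_display} {T : measurableType d}.
Context {P : probability T R} {X : {RV P >-> R}}.
(** In other words, [X] is almost surely a natural number. *)
Hypothesis X_nat : \sum_(j <oo) (pmf X j%:R)%:E = 1.

Let F (j : nat) : set T := X @^-1` [set j%:R].

Let mF j : measurable (F j).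
Proof. exact: measurable_funPTI. Qed.

Let tF : trivIset setT F.
Proof.
by move=> i j _ _ [w []]; rewrite /F /= => -> /eqP; rewrite eqr_nat => /eqP.
Qed.

Let mUF : measurable (\bigcup_j F j).
Proof. exact: bigcup_measurable. Qed.

Let PF j : P (F j) = (pmf X j%:R)%:E.
Proof. by rewrite /pmf fineK // fin_num_measure. Qed.

(** The fibres [F j] are disjoint, so by countable additivity their union has measure 1. *)
Let P_compl : P (~` \bigcup_j F j) = 0.
Proof.
have P_UF : P (\bigcup_j F j) = 1.
  rewrite measure_semi_bigcup // -X_nat.
  by apply: eq_eseriesr => j _; exact: PF.
by rewrite probability_setC // P_UF subee.
Qed.

(** Off a null set the space is the disjoint union of the fibres [F j], and [g (X w)] is constant on
    each; nonnegativity of [g] lets the integral split over them. *)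
Lemma ge0_integral_pmf_nat (g : R -> R) :
  measurable_fun setT g -> (forall x, 0 <= g x)%R ->
  \int[P]_w (g (X w))%:E = \sum_(j <oo) (g j%:R * pmf X j%:R)%:E.
Proof.
move=> mg g0.
have mgX : measurable_fun setT (fun w => (g (X w))%:E).
  by apply/measurable_EFinP; exact: measurableT_comp.
rewrite (ge0_negligible_integral (measurableC mUF)) //; last first.
  by move=> w _; rewrite lee_fin.
rewrite setTD setCK ge0_integral_bigcup //; last 2 first.
- exact: measurable_funTS.
- by move=> w _; rewrite lee_fin.
apply: eq_eseriesr => j _; rewrite EFinM -PF -integral_cst //.
by apply: eq_integral => w; rewrite inE => ->.
Qed.

Lemma ae_eq_nat (f g : R -> R) : (forall j : nat, f j%:R = g j%:R)%R ->
  ae_eq P setT (fun w => (f (X w))%:E) (fun w => (g (X w))%:E).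
Proof.
move=> fg; exists (~` \bigcup_j F j); split => //; first exact: measurableC.
by move=> w /= nfg [j _ /= Xw]; apply: nfg => _; rewrite Xw fg.
Qed.

End nat_supported.

Section poisson_factorial_moment.
Local Open Scope ereal_scope.
Context {R : realType} {d : measure_display} {T : measurableType d}.
Context {P : probability T R} {X : {RV P >-> R}} {rate : R}.
Hypotheses (rate_gt0 : (0 < rate)%R) (hX : poisson_RV X rate).

Let X_nat : \sum_(j <oo) (pmf X j%:R)%:E = 1.
Proof. by under eq_eseriesr do rewrite hX; exact: poisson_pmf_series. Qed.

Let measurable_rffactX k :
  measurable_fun setT (fun w => (rffact (X w) k)%:E).
Proof.
apply/measurable_EFinP.
exact: (measurableT_comp (measurable_rffact R k)).
Qed.

(* The absolute value is needed because [rffact (X w) k] may be negative on the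
   null set where [X w] is not a natural number. *)
Let integral_norm_rffact k :
  \int[P]_w (`|rffact (X w) k|)%:E = (rate ^+ k)%:E.
Proof.
rewrite (ge0_integral_pmf_nat X_nat (fun x => `|rffact x k|)%R) //; last first.
  by apply: measurableT_comp => //; exact: measurable_rffact.
under eq_eseriesr do rewrite hX rffact_natr ger0_norm //.
exact: poisson_ffact_series.
Qed.

(** Falling factorials change sign on the reals, so linearity of the integral in the final
    computation rests on this. *)
Lemma poisson_rffact_integrable k :
  P.-integrable setT (fun w => (rffact (X w) k)%:E).
Proof.
apply/integrableP; split; first exact: measurable_rffactX.
by under eq_integral do rewrite abse_EFin; rewrite integral_norm_rffact ltry.
Qed.

(** At natural arguments [rffact] is nonnegative, so it agrees almost surely with its absolute
    value, whose integral is known. *)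
Lemma poisson_factorial_moment k :
  \int[P]_w (rffact (X w) k)%:E = (rate ^+ k)%:E.
Proof.
rewrite -integral_norm_rffact; apply: ae_eq_integral => //.
- apply/measurable_EFinP; apply: measurableT_comp => //.
  exact/measurable_EFinP/measurable_rffactX.
- refine (ae_eq_nat X_nat (fun x => rffact x k) (fun x => `|rffact x k|)%R _).
  by move=> j; rewrite rffact_natr ger0_norm.
Qed.

End poisson_factorial_moment.

Theorem theorem4 (R : realType) (d : measure_display) (T : measurableType d)
    (P : probability T R) (m : nat) (r alpha lambda : R) (X : {RV P >-> R})
    (hm : (0 < m)%N) (hr : 0 <= r) (halpha : 0 < alpha) (hlambda : lambda != 0)
    (hX : poisson_RV X (alpha / m%:R)) (n : nat) :
  ('E_P[fun w => dffact lambda (m%:R * X w + r) n]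
   = (dowling m r lambda n alpha)%:E)%E.
Proof.
have m_gt0 : 0 < m%:R :> R by rewrite ltr0n.
have rate_gt0 : 0 < alpha / m%:R by rewrite divr_gt0.
(* This identity holds at every real argument, so it applies at each [X w], natural or not. *)
have [_ whitney2E] := whitney2P m r lambda n.
pose c k := whitney2 m r lambda n k * m%:R ^+ k.
rewrite unlock.
under eq_integral => w _.
  rewrite whitney2E -sumEFin.
  under eq_bigr do rewrite mulrA -/(c _) EFinM.
  over.
have intX k := poisson_rffact_integrable rate_gt0 hX k.
rewrite integral_sum // => [|k]; last exact: integrableZl.
rewrite /dowling -sumEFin; apply: eq_bigr => k _.
rewrite integralZl // (poisson_factorial_moment rate_gt0 hX) // -EFinM.
congr EFin.
(* The powers combine as [(m * (alpha / m)) ^ k = alpha ^ k], using [m != 0]. *)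
by rewrite /c -mulrA -exprMn mulrC [m%:R * _]mulrC divfK ?gt_eqF // mulrC.
Qed.
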